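(* There exist constants $c>0$, $C>0$, $k_0$, $N_0$ such that for all integers $N\ge N_0$ and $k$ with $k_0\le k\le N$ there is a (deterministic) schedule $\mathcal R$ such that algorithm $\mathrm{SloFI}(N,k;c,\mathcal R)$, in the setting with acknowledgments, allows any station $v$ to transmit successfully within $C\,k\log k\log N$ rounds (counted from its activation), under contention $k$, i.e. for every set of at most $k$ activated stations and every wake-up pattern of these stations.
   Context: Model. There are $N$ stations with distinct IDs from a set $[N]$ of size $N$, attached to a shared channel; time is divided into synchronous rounds. At most $k$ stations are activated (woken up), each in an arbitrary round; the set of activated stations and their activation times (the wake-up pattern) are chosen by a worst-case adversary. There is no global clock: a station activated in round $\tau$ has local round $r\ge1$ in global round $\tau+r-1$, and sees only its local round number. A station transmits successfully in a round if it is the only station transmitting in that round. In the setting with acknowledgments, a station that transmits successfully learns this and immediately switches off (never transmits again). Collisions are not detected. Algorithm $\mathrm{SloFI}(N,k;c,\mathcal R)$ (non-adaptive). Let $T=ck\log N$. The schedule $\mathcal R$ consists of bits $\mathcal R_{v,i,j}\in\{0,1\}$ for each station $v$, each phase $i=0,1,\dots,2\log k$, and each $j=1,\dots,T$. A station $v$, from its activation until it switches off, transmits in round $iT+j$ of its local clock if and only if $\mathcal R_{v,i,j}=1$; after phase $2\log k$ it is silent. Logarithms $\log$ are base 2. Quantities such as $ck\log N$ and $2\log k$ are rounded up to integers. *)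

(* Defs.v *)
From mathcomp Require Import all_boot all_order all_algebra.
From mathcomp Require Import reals exp.

Set Implicit Arguments.
Unset Strict Implicit.
Unset Printing Implicit Defensive.

Import Order.TTheory GRing.Theory Num.Theory.

Definition log2 (R : realType) (x : R) : R := (ln x / ln 2)%R.

(* [Num.ceil] is int-valued; the absolute value only casts it to nat, since the
   arguments below are nonnegative whenever 0 < c, 0 < k and 0 < N. *)
Definition last_phase (R : realType) (k : nat) : nat :=
  `|Num.ceil (2 * log2 (k%:R : R))%R|%N.

Definition phase_length (R : realType) (c : R) (k N : nat) : nat :=
  `|Num.ceil (c * k%:R * log2 (N%:R : R))%R|%N.

(* Stations are identified with their IDs in 'I_N. The bits of a schedule are
   indexed by the station, the phase i = 0, ..., L and the position
   j = 1, ..., T within the phase; position j is encoded by the ordinal j - 1. *)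
Definition schedule (N L T : nat) := 'I_N -> 'I_L.+1 -> 'I_T -> bool.

(* Whether v, if it is not switched off, transmits in its local round r >= 1. *)
Definition slofi (N L T : nat) (S : schedule N L T) (v : 'I_N) (r : nat) : bool :=
  [exists i : 'I_L.+1, exists j : 'I_T, (r == i * T + j.+1) && S v i j].

Section Channel.

Variables (N : nat).
(* act v r: the non-adaptive algorithm prescribes that v transmits in its local
   round r >= 1. *)
Variable act : 'I_N -> nat -> bool.
(* The wake-up pattern: the set of activated stations and the global round in
   which each of them is activated (wake v is irrelevant for v outside A). *)
Variables (A : {set 'I_N}) (wake : 'I_N -> nat).

(* The stations transmitting in global round t, when those of [off] have been
   switched off before round t. Local round r of v is global round
   wake v + r - 1. *)
Definition transmitters_of (off : {set 'I_N}) (t : nat) : {set 'I_N} :=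
  [set v in A | [&& v \notin off, wake v <= t & act v (t - wake v).+1]].

(* The stations switched off before global round t, through the acknowledgment
   of an earlier successful transmission. *)
Fixpoint switched_off (t : nat) : {set 'I_N} :=
  if t is t'.+1 then
    let off := switched_off t' in
    let X := transmitters_of off t' in
    if #|X| == 1 then off :|: X else off
  else set0.

Definition transmitters (t : nat) : {set 'I_N} :=
  transmitters_of (switched_off t) t.

Definition successful (v : 'I_N) (t : nat) : Prop := transmitters t = [set v].

Definition succeeds_within (R : realType) (v : 'I_N) (B : R) : Prop :=
  exists r : nat,
    [/\ 1 <= r, (r%:R <= B)%R & successful v (wake v + r - 1)].

End Channel.

(* Main.v *)
Require Import Defs.
From mathcomp Require Import all_boot all_order all_algebra.
From mathcomp Require Import reals exp.
From mathcomp Require Import ring lra zify.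

(* The bits are drawn independently, with probability
   p_i = min (2^i / 4k, 1/2) in phase i.  Let the load of a round be the sum of
   the current transmission probabilities of the stations still switched on.
   In a window of T rounds whose loads all lie in [1/8, 1/2], each round
   isolates one station with constant probability, so fewer than k+1 successes
   occur with probability exp(-Omega(T)).  As T >= 640 k log N, this survives a
   union bound over all the ways in which at most k stations can be switched on
   and off relative to the window; and since every success switches off another
   station, some schedule admits no such window at all.
   For this schedule the load never exceeds 1/2: fresh stations contribute at
   most k p_0 <= 1/4 and the probability of a station at most doubles in T
   rounds, so at the first time the load exceeds 1/2 the preceding T rounds
   would form a forbidden window.  Likewise a station that remains on throughout
   its last phase keeps the load at least p_L >= 1/8 for T rounds, which is
   impossible; hence every station succeeds before that phase ends. *)

Set Implicit Arguments.
Unset Strict Implicit.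
Unset Printing Implicit Defensive.

Import Order.TTheory GRing.Theory Num.Theory.

(** * Independent random bits, exponential moments and the union bound *)

Section Expectation.
Local Open Scope ring_scope.

Variables (R : realType) (I : eqType) (p : I -> R).
Hypothesis p01 : forall i, 0 <= p i <= 1.

Implicit Types (b : I -> bool) (s c : seq I) (F G : (I -> bool) -> R).

Definition set_bit b (i : I) (x : bool) : I -> bool :=
  fun j => if j == i then x else b j.

(* The bits at the positions in [s] are drawn independently, bit [i] being 1
   with probability [p i]; the other bits are those of [b]. *)
Fixpoint expectation s F b : R :=
  if s is i :: s' then
    p i * expectation s' F (set_bit b i true)
    + (1 - p i) * expectation s' F (set_bit b i false)
  else F b.

Definition depends_on (D : pred I) F :=
  forall b b', {in D, b =1 b'} -> F b = F b'.

Lemma set_bit_eq (D : pred I) b b' i x :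
  {in D, b =1 b'} -> {in D, set_bit b i x =1 set_bit b' i x}.
Proof. by move=> bb j Dj; rewrite /set_bit; case: eqP => // _; apply: bb. Qed.

Lemma set_bit_out (D : pred I) b i x : ~~ D i -> {in D, set_bit b i x =1 b}.
Proof.
move=> nDi j Dj; rewrite /set_bit; case: eqP => // ji.
by move: Dj nDi; rewrite ji unfold_in => ->.
Qed.

Lemma expectation_depends (D : pred I) s F :
  depends_on D F -> depends_on D (expectation s F).
Proof.
move=> dF; elim: s => [|i s IH] b b' bb /=; first exact: dF.
by rewrite !(IH _ _ (set_bit_eq i _ bb)).
Qed.

Lemma expectation_le s F G b :
  (forall b, F b <= G b) -> expectation s F b <= expectation s G b.
Proof.
move=> FG; elim: s b => [|i s IH] b //=; have /andP[p0 p1] := p01 i.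
by apply: lerD; apply: ler_wpM2l => //; rewrite subr_ge0.
Qed.

Lemma eq_expectation s F G b : F =1 G -> expectation s F b = expectation s G b.
Proof. by move=> FG; elim: s b => [|i s IH] b //=; rewrite !IH. Qed.

Lemma expectation_affine s (x y : R) F G b :
  expectation s (fun b => x * F b + y * G b) b
  = x * expectation s F b + y * expectation s G b.
Proof. by elim: s b => [|i s IH] b //=; rewrite !IH; ring. Qed.

Lemma expectation_cst s (x : R) b : expectation s (fun=> x) b = x.
Proof. by elim: s b => [|i s IH] b //=; rewrite !IH; ring. Qed.

Lemma expectation_sum (T : Type) (r : seq T) (P : pred T)
    (F : T -> (I -> bool) -> R) s b :
  expectation s (fun b => \sum_(x <- r | P x) F x b) b
  = \sum_(x <- r | P x) expectation s (F x) b.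
Proof.
elim: s b => [|i s IH] b //=.
by rewrite !IH !mulr_sumr -big_split.
Qed.

Lemma expectation_mul (D : pred I) s F G b :
  depends_on D F -> depends_on (predC D) G ->
  expectation s (fun b => F b * G b) b = expectation s F b * expectation s G b.
Proof.
move=> dF dG; elim: s b => [|i s IH] b //=; rewrite !IH.
case Di: (D i).
  have E x : expectation s G (set_bit b i x) = expectation s G b.
    by apply: (expectation_depends s dG); apply: set_bit_out; rewrite /= Di.
  by rewrite !E; ring.
have E x : expectation s F (set_bit b i x) = expectation s F b.
  by apply: (expectation_depends s dF); apply: set_bit_out; rewrite Di.
by rewrite !E; ring.
Qed.

Lemma expectation_out (D : pred I) s F b :
  depends_on D F -> {in s, forall i, ~~ D i} -> expectation s F b = F b.
Proof.
move=> dF; elim: s b => [|i s IH] b sD //=.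
have sD' : {in s, forall j, ~~ D j} by move=> j js; apply: sD; rewrite inE js orbT.
have E x : F (set_bit b i x) = F b.
  by apply: dF; apply: set_bit_out; apply: sD; rewrite inE eqxx.
by rewrite !IH // !E; ring.
Qed.

Lemma expectation_bit s i b : i \in s -> expectation s (fun b => (b i)%:R) b = p i.
Proof.
elim: s b => [|j s IH] b //=; rewrite inE.
case si: (i \in s); first by move=> _; rewrite !IH //; ring.
rewrite orbF => /eqP <-.
have E x : expectation s (fun b => (b i)%:R) (set_bit b i x) = x%:R.
  rewrite (@expectation_out (pred1 i)); first by rewrite /set_bit eqxx.
    by move=> b1 b2 bb; rewrite bb //= inE.
  by move=> j' js; apply: contraFneq si => <-.
by rewrite !E mulr1 mulr0 addr0.
Qed.

(** Derandomization bit by bit: a weighted average of two values is at least the smaller one. *)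
Lemma expectation_witness s F b : exists b', F b' <= expectation s F b.
Proof.
elim: s b => [|i s IH] b /=; first by exists b.
have [b1 H1] := IH (set_bit b i true); have [b0 H0] := IH (set_bit b i false).
have /andP[p0 p1] := p01 i.
case: (lerP (F b1) (F b0)) => [le|lt]; [exists b1|exists b0]; nra.
Qed.

Definition ones c b : R := (count b c)%:R.

Lemma ones_depends c : depends_on (mem c) (ones c).
Proof. by move=> b b' bb; rewrite /ones (eq_in_count bb). Qed.

Lemma expectation_ones s c b :
  {subset c <= s} -> expectation s (ones c) b = \sum_(i <- c) p i.
Proof.
move=> cs; rewrite (@eq_expectation _ _ (fun b => \sum_(i <- c) (b i)%:R)).
  rewrite expectation_sum big_seq [RHS]big_seq; apply: eq_bigr => i ci.
  by rewrite expectation_bit // cs.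
by move=> b'; rewrite /ones -sum1_count natr_sum big_mkcond;
  apply: eq_bigr => i _; case: (b' i).
Qed.

(** Splitting a bit $B$ off the count $B + Y$ gives $(B+Y)(2-B-Y) = B + Y(2-Y) - 2BY$, because $B^2
    = B$. By independence the cross term costs $2 p_i S$, which the growth of the squared sum
    covers. *)
Lemma expectation_isolated s c b : uniq c -> {subset c <= s} ->
  \sum_(i <- c) p i - (\sum_(i <- c) p i) ^+ 2
  <= expectation s (fun b => ones c b * (2 - ones c b)) b.
Proof.
elim: c => [|i c IH] /=.
  move=> _ _; rewrite big_nil (@eq_expectation _ _ (fun=> 0)) ?expectation_cst //.
    by rewrite expr0n /= subr0.
  by move=> b'; rewrite /ones /= mul0r.
move=> /andP[ic uc] cs; have cs' : {subset c <= s}.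
  by move=> j jc; apply: cs; rewrite inE jc orbT.
rewrite big_cons (@eq_expectation _ _
  (fun b => 1 * (1 * (b i)%:R + 1 * (ones c b * (2 - ones c b)))
   + (- 2) * ((b i)%:R * ones c b))); last first.
  by move=> b'; rewrite /ones /= natrD; case: (b' i) => /=; ring.
rewrite !expectation_affine.
rewrite (@expectation_mul (pred1 i) s (fun b => (b i)%:R)); last 2 first.
- by move=> b1 b2 bb; rewrite bb //= inE.
- move=> b1 b2 bb; apply: ones_depends => j jc; apply: bb; rewrite !inE.
  by apply: contraNneq ic => <-.
rewrite expectation_bit ?cs ?inE ?eqxx // expectation_ones //.
have := IH uc cs'; have /andP[p0 p1] := p01 i.
by set S := \sum_(j <- c) p j => H; nra.
Qed.

(** The weight of a Chernoff argument: its product over a window is 2 to the minus number of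
    isolating rounds. *)
Definition halved_if_isolated c b : R := if count b c == 1%N then 1 / 2 else 1.

Lemma expectation_halved s c b : uniq c -> {subset c <= s} ->
  1 / 8 <= \sum_(i <- c) p i <= 1 / 2 ->
  expectation s (halved_if_isolated c) b <= 31 / 32.
Proof.
move=> uc cs /andP[S1 S2]; have E := expectation_isolated b uc cs.
(* [x (2 - x)] is 1 for x = 1 and nonpositive for every other natural x. *)
apply: (@le_trans _ _ (expectation s
  (fun b => 1 * 1 + (- (1 / 2)) * (ones c b * (2 - ones c b))) b)).
  apply: expectation_le => b'; rewrite /halved_if_isolated /ones.
  case: (count b' c) => [|[|n]] /=; [lra | lra |].
  by rewrite -[n.+2]addn2 natrD; have := ler0n R n; nra.
rewrite expectation_affine expectation_cst; move: S1 S2 E; set S := \sum_(i <- c) p i.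
(* On $[1/8, 1/2]$ one has $S - S^2 \ge 7/64$, so the bound is at most $121/128 < 31/32$. *)
by move=> S1 S2 E; nra.
Qed.

Lemma halved_depends c : depends_on (mem c) (halved_if_isolated c).
Proof. by move=> b b' bb; rewrite /halved_if_isolated (eq_in_count bb). Qed.

(** Distinct rounds read disjoint sets of bits, so the expectation of the product factors. *)
Lemma expectation_prod_halved s (c : nat -> seq I) b n :
  (forall t, (t < n)%N -> uniq (c t)) ->
  (forall t, (t < n)%N -> {subset c t <= s}) ->
  (forall t u i, (t < u < n)%N -> i \in c t -> i \notin c u) ->
  (forall t, (t < n)%N -> 1 / 8 <= \sum_(i <- c t) p i <= 1 / 2) ->
  expectation s (fun b => \prod_(t < n) halved_if_isolated (c t) b) b <= (31 / 32) ^+ n.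
Proof.
elim: n => [|n IH] uc cs dc Sc.
  rewrite expr0 (@eq_expectation _ _ (fun=> 1)) ?expectation_cst //.
  by move=> b'; rewrite big_ord0.
rewrite (@eq_expectation _ _ (fun b =>
    halved_if_isolated (c n) b * \prod_(t < n) halved_if_isolated (c t) b)); last first.
  by move=> b'; rewrite big_ord_recr mulrC.
rewrite (@expectation_mul (mem (c n))); first last.
- move=> b1 b2 bb; apply: eq_bigr => t _; apply: halved_depends => i it.
  by apply: bb; rewrite inE /=; apply: dc it; rewrite ltn_ord /=.
- exact: halved_depends.
have ge0 b' : 0 <= halved_if_isolated (c n) b'.
  by rewrite /halved_if_isolated; case: ifP => _; lra.
have ge0' : 0 <= expectation s (halved_if_isolated (c n)) b.
  by rewrite -(expectation_cst s 0 b); apply: expectation_le.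
rewrite exprS; apply: ler_pM => //.
- rewrite -(expectation_cst s 0 b); apply: expectation_le => b'.
  by apply: prodr_ge0 => t _; rewrite /halved_if_isolated; case: ifP => _; lra.
- by apply: expectation_halved; [apply: uc|apply: cs|apply: Sc].
- apply: IH => [t tn|t tn|t u i /andP[tu un]|t tn].
  + by apply: uc; apply: ltnW.
  + by apply: cs; apply: ltnW.
  + by apply: dc; rewrite tu ltnW.
  + by apply: Sc; apply: ltnW.
Qed.

Lemma prod_halved (c : nat -> seq I) b n :
  \prod_(t < n) halved_if_isolated (c t) b
  = (1 / 2) ^+ (\sum_(t < n) (count b (c t) == 1%N)).
Proof.
rewrite -prodrXr; apply: eq_bigr => t _.
by rewrite /halved_if_isolated; case: eqP.
Qed.

(** Markov's inequality and the union bound in one: a single valid [x] with at most [k] isolating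
    rounds would already contribute $2^{-k}$ to [F], whose expectation is smaller. *)
Lemma union_bound s (X : finType) (valid : pred X) (c : X -> nat -> seq I) n k :
  (forall x t, valid x -> (t < n)%N -> uniq (c x t)) ->
  (forall x t, valid x -> (t < n)%N -> {subset c x t <= s}) ->
  (forall x t u i, valid x -> (t < u < n)%N -> i \in c x t -> i \notin c x u) ->
  (forall x t, valid x -> (t < n)%N -> 1 / 8 <= \sum_(i <- c x t) p i <= 1 / 2) ->
  #|X|%:R * (31 / 32) ^+ n < (1 / 2) ^+ k :> R ->
  exists b, forall x, valid x -> (k < \sum_(t < n) (count b (c x t) == 1))%N.
Proof.
move=> uc cs dc Sc lt.
pose F b := \sum_(x | valid x) \prod_(t < n) halved_if_isolated (c x t) b.
have [b Hb] := expectation_witness s F (fun=> false).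
have {}Hb : F b < (1 / 2) ^+ k.
  apply: le_lt_trans Hb (le_lt_trans _ lt).
  rewrite expectation_sum.
  apply: (@le_trans _ _ (\sum_(x | valid x) (31 / 32) ^+ n)).
    apply: ler_sum => x vx; apply: expectation_prod_halved.
    - by move=> t; apply: uc.
    - by move=> t; apply: cs.
    - by move=> t u i; apply: dc.
    - by move=> t; apply: Sc.
  rewrite sumr_const -[leLHS]mulr_natl; apply: ler_wpM2r; first by apply: exprn_ge0; lra.
  by rewrite ler_nat max_card.
exists b => x vx; rewrite ltnNge; apply/negP => le.
have : F b >= (1 / 2) ^+ k.
  rewrite /F (bigD1 x) //= prod_halved.
  rewrite -[leLHS]addr0; apply: lerD.
    by apply: ler_wiXn2l => //; lra.
  by apply: sumr_ge0 => y _; rewrite prod_halved; apply: exprn_ge0; lra.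
by rewrite leNgt Hb.
Qed.

End Expectation.

(** * Successes and switched-off stations *)

Section ChannelFacts.

Variables (N : nat) (act : 'I_N -> nat -> bool) (A : {set 'I_N}) (wake : 'I_N -> nat).

Local Notation off := (switched_off act A wake).
Local Notation tr := (transmitters act A wake).

Definition alive (t : nat) : {set 'I_N} :=
  [set v in A | (v \notin off t) && (wake v <= t)].

Lemma transmittersE t : tr t = [set v in alive t | act v (t - wake v).+1].
Proof. by apply/setP => v; rewrite !inE -!andbA. Qed.

Lemma switched_offS t : off t.+1 = if #|tr t| == 1 then off t :|: tr t else off t.
Proof. by []. Qed.

Lemma switched_off_mono t u : t <= u -> off t \subset off u.
Proof.
move=> /subnKC <-; elim: (u - t) => [|n IH]; first by rewrite addn0.
rewrite addnS switched_offS; case: ifP => // _.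
exact: subset_trans IH (subsetUl _ _).
Qed.

Lemma switched_off_success v t : v \in off t -> exists2 u, u < t & tr u = [set v].
Proof.
elim: t => [|t IH]; first by rewrite inE.
rewrite switched_offS; case: ifP => [/cards1P[w tw]|_].
  rewrite tw !inE => /orP[/IH[u ut tu]|/eqP ->]; first by exists u; rewrite // ltnW.
  by exists t.
by move=> /IH[u ut tu]; exists u; rewrite // ltnW.
Qed.

Lemma switched_off_sub t : off t \subset A.
Proof.
apply/subsetP => v /switched_off_success[u _ tu].
have : v \in tr u by rewrite tu inE.
by rewrite !inE => /andP[].
Qed.

(** Acknowledgments enter here: a transmitting station is still on, so each success adds a new
    station to the switched-off ones. *)
Lemma card_switched_off t n :
  #|off (t + n)| = #|off t| + \sum_(i < n) (#|tr (t + i)| == 1).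
Proof.
elim: n => [|n IH]; first by rewrite addn0 big_ord0 addn0.
rewrite big_ord_recr /= addnA -IH addnS switched_offS.
case: eqP => [t1|_]; last by rewrite addn0.
rewrite cardsU t1 (_ : _ :&: _ = set0) ?cards0 ?subn0 //.
by apply/setP => v; rewrite !inE; case: (v \in off _); rewrite ?andbF.
Qed.

Lemma num_successes_le t n : \sum_(i < n) (#|tr (t + i)| == 1) <= #|A|.
Proof.
apply: leq_trans (subset_leq_card (switched_off_sub (t + n))).
by rewrite card_switched_off leq_addl.
Qed.

Lemma alive_earlier v t u : u <= t -> wake v <= u -> v \in alive t -> v \in alive u.
Proof.
move=> ut wu; rewrite !inE => /and3P[-> nv _]; rewrite wu andbT /=.
by apply: contra nv; apply/subsetP/switched_off_mono.
Qed.

End ChannelFacts.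

(** * Random schedules and window patterns *)

Section Schedule.

Variables (R : realType) (N k L T : nat).
Hypotheses (k_gt0 : 0 < k) (T_gt0 : 0 < T) (kL : k ^ 2 <= 2 ^ L).

Definition phase_prob (i : nat) : R := Num.min (2 ^+ i / (4 * k%:R))%R (1 / 2)%R.

(** Bits are addressed by the station and its age, that is, its local round minus 1. *)
Definition bit_prob (x : 'I_N * nat) : R := phase_prob (x.2 %/ T).

Definition schedule_of (b : 'I_N * nat -> bool) : schedule N L T :=
  fun v i j => b (v, i * T + j).

Lemma slofi_schedule_of b v q :
  slofi (schedule_of b) v q.+1 = (q < L.+1 * T) && b (v, q).
Proof.
apply/existsP/andP => [[i /existsP[j /andP[/eqP]]]|[qH bq]].
  rewrite addnS => -[->] bv; split=> //.
  by rewrite mulSn addnC -addSn leq_add ?ltn_ord // leq_mul2r -ltnS ltn_ord orbT.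
have iP : q %/ T < L.+1 by rewrite ltn_divLR.
have jP : q %% T < T by rewrite ltn_mod.
exists (Ordinal iP); apply/existsP; exists (Ordinal jP) => /=.
by rewrite addnS -divn_eq eqxx /schedule_of /= -divn_eq.
Qed.

Let kR_gt0 : (0 < k%:R :> R)%R.
Proof. by rewrite ltr0n. Qed.

Lemma phase_prob01 i : (0 <= phase_prob i <= 1)%R.
Proof.
rewrite /phase_prob le_min ge_min; apply/andP; split; last by apply/orP; right; lra.
apply/andP; split; last lra.
by apply: divr_ge0; [apply: exprn_ge0|apply: mulr_ge0]; rewrite ?ler0n.
Qed.

Lemma phase_prob0 : (k%:R * phase_prob 0 <= 1 / 4)%R.
Proof.
apply: (@le_trans _ _ (k%:R * (1 / (4 * k%:R)))%R).
  by rewrite ler_pM2l // /phase_prob expr0 ge_min lexx.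
by rewrite le_eqVlt; apply/orP; left; apply/eqP; field; rewrite gt_eqF.
Qed.

Lemma phase_prob_mono i j : i <= j -> (phase_prob i <= phase_prob j)%R.
Proof.
move=> ij; rewrite /phase_prob le_min ge_min ge_min lexx !orbT andbT.
by rewrite ler_pM2r ?ler_weXn2l ?ler1n // invr_gt0 mulr_gt0.
Qed.

Lemma phase_probS i : (phase_prob i.+1 <= 2 * phase_prob i)%R.
Proof.
rewrite /phase_prob {2}/Num.min; case: ifP => _; first by rewrite ge_min exprS !mulrA lexx.
by rewrite ge_min; apply/orP; right; lra.
Qed.

Lemma phase_prob_last : (1 / 8 <= phase_prob L)%R.
Proof.
rewrite /phase_prob le_min; apply/andP; split; last lra.
rewrite ler_pdivlMr ?mulr_gt0 //.
have : ((k ^ 2)%:R <= (2 ^ L)%:R :> R)%R by rewrite ler_nat.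
rewrite !natrX; have : (1 <= k%:R :> R)%R by rewrite ler1n.
by nra.
Qed.

(* What a window of [T] rounds sees of a run: for each of at most [k] stations,
   the station itself, its delay, i.e. the number of rounds from the moment
   [L.+1 * T] rounds before the window until its activation, and the
   number of rounds of the window in which it is not yet switched off (0 for
   unused slots). *)
Definition pattern := {ffun 'I_k -> 'I_N * 'I_(L.+2 * T) * 'I_T.+1}.
Implicit Types (x : pattern).

Definition station x i : 'I_N := (x i).1.1.
Definition delay x i : nat := (x i).1.2.
Definition stop x i : nat := (x i).2.

Definition active x (t : nat) (i : 'I_k) : bool :=
  (t < stop x i) && (delay x i <= t + L.+1 * T).

Definition bits x (t : nat) : seq ('I_N * nat) :=
  [seq (station x i, t + L.+1 * T - delay x i) | i <- enum 'I_k & active x t i].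

Definition injective_pattern x : bool :=
  [forall i, forall j,
     [&& 0 < stop x i, 0 < stop x j & station x i == station x j] ==> (i == j)].

Definition valid x : bool :=
  injective_pattern x &&
  [forall t : 'I_T, (1 / 8 <= \sum_(z <- bits x t) bit_prob z <= 1 / 2)%R].

(** A run of at most [k] stations has at most [k] successes, so a good [b] excludes every run with a
    window described by a valid pattern. *)
Definition good (b : 'I_N * nat -> bool) : Prop :=
  forall x, valid x -> k < \sum_(t < T) (count b (bits x t) == 1).

Lemma injective_patternP x i j t u : injective_pattern x ->
  active x t i -> active x u j -> station x i = station x j -> i = j.
Proof.
move=> /forallP/(_ i)/forallP/(_ j)/implyP H /andP[ti _] /andP[uj _] ij.
by apply/eqP/H; rewrite (leq_trans _ ti) // (leq_trans _ uj) //= ij.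
Qed.

Lemma bits_uniq x t : injective_pattern x -> uniq (bits x t).
Proof.
move=> xi; rewrite map_inj_in_uniq; first exact/filter_uniq/enum_uniq.
move=> i j; rewrite !mem_filter => /andP[ai _] /andP[aj _] [ij _].
exact: injective_patternP ai aj ij.
Qed.

(** A position shared by two rounds would give one station the same age in both. *)
Lemma bits_disjoint x t u z : injective_pattern x -> t < u ->
  z \in bits x t -> z \notin bits x u.
Proof.
move=> xi tu /mapP[i]; rewrite mem_filter => /andP[ai _] ->.
apply/negP => /mapP[j]; rewrite mem_filter => /andP[aj _] [ij].
have {}ij := injective_patternP xi ai aj ij; rewrite -ij in aj *.
move: ai aj => /andP[_ ai] /andP[_ aj]; lia.
Qed.

Lemma good_exists :
  (#|{: pattern}|%:R * (31 / 32) ^+ T < (1 / 2) ^+ k :> R)%R -> exists b, good b.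
Proof.
apply: (@union_bound R _ bit_prob _ [seq (v, q) | v <- enum 'I_N, q <- iota 0 (L.+2 * T)]).
- by move=> z; apply: phase_prob01.
- by move=> x t /andP[xi _] _; apply: bits_uniq.
- move=> x t _ tT z /mapP[i]; rewrite mem_filter => /andP[ai _] ->.
  apply/allpairsP; exists (station x i, t + L.+1 * T - delay x i) => /=.
  split=> //; first by rewrite mem_enum.
  by rewrite mem_iota /= mulSn; lia.
- by move=> x t u z /andP[xi _] /andP[tu _]; apply: bits_disjoint.
- by move=> x t /andP[_ /forallP H] tT; apply: (H (Ordinal tT)).
Qed.

(** * The load along a run of a good schedule *)

Section Run.

Variables (b : 'I_N * nat -> bool).
Hypothesis good_b : good b.
Variables (A : {set 'I_N}) (wake : 'I_N -> nat).
Hypothesis Ak : #|A| <= k.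

Local Notation act := (slofi (schedule_of b)).
Local Notation off := (switched_off act A wake).
Local Notation live := (alive act A wake).
Local Notation tr := (transmitters act A wake).

Definition load (t : nat) : R := (\sum_(v in live t) phase_prob ((t - wake v) %/ T))%R.

Definition live_bits (t : nat) : seq ('I_N * nat) :=
  [seq (v, t - wake v) | v <- enum (live t)].

Lemma loadE t : load t = (\sum_(z <- live_bits t) bit_prob z)%R.
Proof. by rewrite /load /live_bits big_map big_enum. Qed.

Lemma live_bits_uniq t : uniq (live_bits t).
Proof. by rewrite map_inj_uniq ?enum_uniq // => u v []. Qed.

(** Until the end of its last phase a live station follows its bits; afterwards it would be silent
    whatever [b] says. *)
Lemma count_live_bits t : (forall v, v \in live t -> t - wake v < L.+1 * T) ->
  count b (live_bits t) = #|tr t|.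
Proof.
move=> young; rewrite transmittersE count_map -size_filter cardE.
apply: perm_size; apply: uniq_perm => [||v].
- exact/filter_uniq/enum_uniq.
- exact: enum_uniq.
rewrite mem_filter !mem_enum [RHS]inE andbC slofi_schedule_of.
by case: (boolP (v \in live t)) => //= /young ->.
Qed.

Section Window.

Variables (v0 : 'I_N) (t0 : nat).
Hypothesis young :
  forall t v, t < T -> v \in live (t0 + t) -> t0 + t - wake v < L.+1 * T.

Let st (i : 'I_k) := nth v0 (enum A) i.

Let LT_gt0 : 0 < L.+2 * T.
Proof. by rewrite muln_gt0. Qed.

(** The guard keeps the delay in range and free of truncated subtraction; where it fails, [stop] is
    0 and the default values are harmless. A station that is never off in the window gets [stop]
    equal to [T]. *)
Definition window_pattern : pattern :=
  [ffun i => (st i, insubd (Ordinal LT_gt0) (wake (st i) + L.+1 * T - t0),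
     if [&& i < #|A|, t0 < wake (st i) + L.+1 * T & wake (st i) < t0 + T]
     then inord (find (fun t => st i \in off (t0 + t)) (iota 0 T)) else ord0)].

(** Switching off is permanent, so the first such round determines the state throughout the
    window. *)
Lemma find_off v t : t < T ->
  (t < find (fun t => v \in off (t0 + t)) (iota 0 T)) = (v \notin off (t0 + t)).
Proof.
move=> tT; apply/idP/idP => [lt|nv].
  by have := before_find 0 lt; rewrite nth_iota // => ->.
rewrite ltnNge; apply: contra nv => le.
have fT : find (fun t => v \in off (t0 + t)) (iota 0 T) < T by apply: leq_ltn_trans tT.
have := nth_find 0 (_ : has (fun t => v \in off (t0 + t)) (iota 0 T)).
rewrite has_find size_iota => /(_ fT); rewrite nth_iota //.
by apply/subsetP/switched_off_mono; rewrite leq_add2l.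
Qed.

Lemma active_window i t : t < T ->
  active window_pattern t i = (i < #|A|) && (st i \in live (t0 + t)).
Proof.
move=> tT; rewrite /active /stop /delay ffunE /=.
have iA : i < #|A| -> st i \in A.
  by move=> iA; rewrite -mem_enum mem_nth // -cardE.
case: (boolP (i < #|A|)) => //= {}/iA iA.
apply/idP/idP.
  case: ifP => //= /andP[h1 h2].
  have sz : find (fun t => st i \in off (t0 + t)) (iota 0 T) < T.+1.
    by rewrite ltnS -[leqRHS](size_iota 0 T) find_size.
  rewrite inordK // find_off // val_insubd.
  have -> : wake (st i) + L.+1 * T - t0 < L.+2 * T by rewrite [L.+2 * T]mulSn; lia.
  move=> /andP[no le]; rewrite !inE iA no /=; lia.
move=> li; have := young tT li; move: (li); rewrite !inE => /and3P[_ no wt] yg.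
have h1 : t0 < wake (st i) + L.+1 * T by lia.
have h2 : wake (st i) < t0 + T by lia.
rewrite h1 h2 /=.
have sz : find (fun t => st i \in off (t0 + t)) (iota 0 T) < T.+1.
  by rewrite ltnS -[leqRHS](size_iota 0 T) find_size.
rewrite inordK // find_off // no val_insubd.
have -> : wake (st i) + L.+1 * T - t0 < L.+2 * T by rewrite [L.+2 * T]mulSn; lia.
by rewrite /=; lia.
Qed.

Lemma window_pattern_injective : injective_pattern window_pattern.
Proof.
apply/forallP => i; apply/forallP => j; apply/implyP => /and3P[].
rewrite /stop /station !ffunE /=.
case: ifP => // /andP[iA _] _; case: ifP => // /andP[jA _] _.
by rewrite /st nth_uniq ?enum_uniq -?cardE // => /eqP/val_inj ->.
Qed.

Lemma bits_window t : t < T -> perm_eq (bits window_pattern t) (live_bits (t0 + t)).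
Proof.
move=> tT; apply: uniq_perm.
- exact/bits_uniq/window_pattern_injective.
- exact: live_bits_uniq.
have E i : active window_pattern t i ->
    t + L.+1 * T - delay window_pattern i = t0 + t - wake (st i).
  move=> ai; have := ai; rewrite active_window // => /andP[_ li].
  have := young tT li; move: (li); rewrite inE => /and3P[_ _ wt].
  rewrite /delay ffunE /= val_insubd.
  have -> : wake (st i) + L.+1 * T - t0 < L.+2 * T by rewrite [L.+2 * T]mulSn; lia.
  by rewrite /=; lia.
have S i : station window_pattern i = st i by rewrite /station ffunE.
move=> z; apply/mapP/mapP => [[i]|[v]].
  rewrite mem_filter => /andP[ai _] ->; exists (st i); last by rewrite E ?S.
  by move: ai; rewrite active_window // mem_enum => /andP[].
rewrite mem_enum => lv ->.
have vA : v \in enum A by rewrite mem_enum; move: lv; rewrite inE => /andP[].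
have iA : index v (enum A) < #|A| by rewrite cardE index_mem.
(* Contention at most [k] guarantees a slot for every station. *)
have ik := leq_trans iA Ak.
have sv : st (Ordinal ik) = v by rewrite /st /= nth_index.
have ai : active window_pattern t (Ordinal ik) by rewrite active_window //= iA sv.
exists (Ordinal ik); last by rewrite E // S sv.
by rewrite mem_filter ai mem_enum.
Qed.

Lemma window_load : ~ (forall t, t < T -> (1 / 8 <= load (t0 + t) <= 1 / 2)%R).
Proof.
move=> H; have vx : valid window_pattern.
  rewrite /valid window_pattern_injective; apply/forallP => t.
  by rewrite (perm_big _ (bits_window (ltn_ord t))) -loadE H.
have := good_b vx; apply/negP; rewrite -leqNgt; apply: leq_trans Ak.
apply: leq_trans (num_successes_le act A wake t0 T).
apply: leq_sum => t _; rewrite (permP (bits_window (ltn_ord t))) count_live_bits //.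
by move=> v; apply: young.
Qed.

End Window.

Lemma load_phase0 t :
  (\sum_(v in live t | (t - wake v < T)%N) phase_prob ((t - wake v) %/ T) <= 1 / 4)%R.
Proof.
apply: (@le_trans _ _ (\sum_(v in A) phase_prob 0)%R).
  rewrite [leRHS](bigID (fun v => (v \in live t) && (t - wake v < T))) /=.
  rewrite -[leLHS]addr0; apply: lerD; last first.
    by apply: sumr_ge0 => v _; case/andP: (phase_prob01 0).
  rewrite [leRHS](eq_bigl (fun v => (v \in live t) && (t - wake v < T))); last first.
    by move=> v; rewrite inE; case: (v \in A).
  by apply: ler_sum => v /andP[_ young]; rewrite divn_small.
rewrite sumr_const -[leLHS]mulr_natl; apply: le_trans phase_prob0.
by apply: ler_wpM2r; [case/andP: (phase_prob01 0) | rewrite ler_nat].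
Qed.

(* A station of age at least [T] at time [t] was already alive at time [u],
   with at least half its present probability; the others are in phase 0. *)
Lemma load_growth t u : u <= t <= u + T -> (load t <= 1 / 4 + 2 * load u)%R.
Proof.
move=> /andP[ut tu]; rewrite /load (bigID (fun v => t - wake v < T)) /=.
apply: lerD; first exact: load_phase0.
rewrite mulr_sumr [leRHS](bigID (fun v => (v \in live t) && ~~ (t - wake v < T))) /=.
rewrite -[leLHS]addr0; apply: lerD; last first.
  by apply: sumr_ge0 => v _; apply: mulr_ge0 => //; case/andP: (phase_prob01 ((u - wake v) %/ T)).
rewrite [leRHS](eq_bigl (fun v => (v \in live t) && ~~ (t - wake v < T))); last first.
  move=> v; case lv: (v \in live t); rewrite ?andbF //=.
  case: ltnP => age; rewrite ?andbF // andbT; apply: (alive_earlier ut) lv.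
  by lia.
apply: ler_sum => v /andP[_ old]; apply: le_trans (phase_probS _).
apply/phase_prob_mono/(@leq_trans ((u - wake v + T) %/ T)).
  by apply: leq_div2r; lia.
by rewrite divnDr // divnn T_gt0 addn1.
Qed.

(** Both claims go through one strong induction: [window_load] needs the upper bound on the load and
    the youth of the stations in the preceding [T] rounds. *)
Lemma load_bounded t :
  (load t <= 1 / 2)%R /\ forall v, v \in live t -> t - wake v < L.+1 * T.
Proof.
elim/ltn_ind: t => t IH.
have window u : t = u + T -> ~ (forall i, i < T -> (1 / 8 <= load (u + i))%R).
  (* If [A] is empty the load is 0; otherwise a member serves as default station. *)
  move=> tu low; case: (set_0Vmem A) => [A0|[v0 _]].
    have := low 0 T_gt0; rewrite /load big1; first by lra.
    by move=> v; rewrite inE A0 inE.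
  apply: (@window_load v0 u) => [i v iT|i iT].
    by apply: (proj2 (IH _ _)); rewrite tu ltn_add2l.
  by rewrite low //= (proj1 (IH _ _)) // tu ltn_add2l.
split.
  (* By [load_growth], a load above 1/2 forces a load above 1/8 in each of the preceding [T] rounds.
     If $t < T$, all stations are in phase 0 and the load is at most 1/4. *)
  rewrite leNgt; apply/negP => high; case: (leqP T t) => [Tt|tT].
    apply: (window (t - T)); first by rewrite subnK.
    move=> i iT; have := @load_growth t (t - T + i).
    have -> : t - T + i <= t <= t - T + i + T by lia.
    by move=> /(_ isT); lra.
  have := load_phase0 t; rewrite (eq_bigl (mem (live t))).
    by rewrite -/(load t); lra.
  by move=> v /=; rewrite (leq_ltn_trans (leq_subr _ _) tT) andbT.
move=> v lv; rewrite ltnNge; apply/negP => old.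
have Tt : T <= t by rewrite mulSn in old; lia.
apply: (window (t - T)); first by rewrite subnK.
(* In these rounds [v] has age at least [L * T], so it transmits with probability at least that of
   phase [L]. *)
move=> i iT; have lvi : v \in live (t - T + i).
  by apply: alive_earlier lv; rewrite mulSn in old; lia.
apply: (le_trans phase_prob_last); rewrite /load (bigD1 v) //=.
rewrite -[leLHS]addr0; apply: lerD.
  by apply: phase_prob_mono; rewrite leq_divRL //; rewrite mulSn in old; lia.
by apply: sumr_ge0 => w _; case/andP: (phase_prob01 ((t - T + i - wake w) %/ T)).
Qed.

Lemma success_by_last_phase v : v \in A ->
  exists2 r, 1 <= r <= L.+1 * T & successful act A wake v (wake v + r - 1).
Proof.
move=> vA; set t := wake v + L.+1 * T.
have : v \in off t.
  apply/negPn/negP => nv; have := proj2 (load_bounded t) v.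
  by rewrite inE vA nv leq_addr addKn ltnn => /(_ isT).
case/switched_off_success => u ut tu; have : v \in tr u by rewrite tu inE.
rewrite inE => /and4P[_ _ wu _]; exists (u - wake v).+1; first by rewrite /t in ut; lia.
by rewrite /successful (_ : wake v + _ - 1 = u) //; lia.
Qed.

End Run.

End Schedule.

(** * Base-2 logarithms and rounding *)

Section Logarithm.
Local Open Scope ring_scope.

Variable R : realType.

Lemma ln2_gt0 : 0 < ln 2 :> R.
Proof. by apply: ln_gt0; rewrite ltr1n. Qed.

Lemma log2X (x : R) n : 0 < x -> log2 (x ^+ n) = n%:R * log2 x.
Proof. by move=> x0; rewrite /log2 lnXn // -[_ *+ _]mulr_natl mulrA. Qed.

Lemma log2_2X n : log2 (2 ^+ n : R) = n%:R.
Proof. by rewrite log2X // /log2 divff ?mulr1 // gt_eqF // ln2_gt0. Qed.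

Lemma ler_log2 (x y : R) : 0 < x -> 0 < y -> (log2 x <= log2 y) = (x <= y).
Proof. by move=> x0 y0; rewrite /log2 ler_pM2r ?invr_gt0 ?ln2_gt0 // ler_ln. Qed.

Lemma log2_nat_le (n : nat) : (0 < n)%N -> log2 (n%:R : R) <= n%:R.
Proof.
move=> n0; rewrite -[leRHS]log2_2X ler_log2 ?exprn_gt0 ?ltr0n //.
by rewrite -natrX ler_nat ltnW // ltn_expl.
Qed.

Lemma absz_ceil_itv (x : R) : 0 <= x -> x <= `|Num.ceil x|%N%:R < x + 1.
Proof.
move=> x0; have /andP[h1 h2] := ceil_itv x.
rewrite natr_absz ger0_norm; last by rewrite ceil_ge0; lra.
by rewrite h2 /= -ltrBlDr -[1]/(1%:~R) -intrB.
Qed.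

End Logarithm.

(** * Numerical estimates and the choice of constants *)

Lemma card_pattern N k L T :
  #|{: pattern N k L T}| = (N * (L.+2 * T) * T.+1) ^ k.
Proof. by rewrite card_ffun !card_prod !card_ord. Qed.

(** There are at most $2^{18nk}$ patterns, each failing with weight at most $2^{-20nk}$ because $640
    = 32 \cdot 20$; the product $2^{-2nk}$ is below $2^{-k}$. *)
Lemma failure_prob_lt (R : realType) N k L T :
  1000 <= N -> 0 < k -> L <= N.*2.+1 -> T.+1 <= N ^ 3 -> 640 * k * trunc_log 2 N <= T ->
  (#|{: pattern N k L T}|%:R * (31 / 32) ^+ T < (1 / 2) ^+ k :> R)%R.
Proof.
move=> N0 k0 LN TN; set n := trunc_log 2 N => nT.
have n1 : 0 < n by rewrite trunc_log_gt0 /=; lia.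
have card_le : #|{: pattern N k L T}| <= 2 ^ (18 * n * k).
  rewrite card_pattern expnM leq_exp2r //.
  (* The exponent is $1 + 2 + 3 + 3$, from $L + 2 \le N^2$ and $T + 1 \le N^3$. *)
  apply: (@leq_trans (N ^ 9)).
    apply: (@leq_trans (N * (N ^ 2 * N ^ 3) * N ^ 3)).
      apply: leq_mul => //; apply: leq_mul => //; apply: leq_mul; last exact: ltnW.
      by rewrite expnS expn1; nia.
    by rewrite -!expnD -expnS -expnD.
  (* Here $N < 2^{n+1}$, and $9(n+1) \le 18n$. *)
  apply: (@leq_trans ((2 ^ n.+1) ^ 9)); first by rewrite leq_exp2r // ltnW // trunc_log_ltn.
  by rewrite -expnM leq_exp2l //; lia.
have p8 : ((31 / 32) ^+ 8 <= 4 / 5 :> R)%R by rewrite !exprS expr0; lra.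
have p32 : ((31 / 32) ^+ 32 <= 1 / 2 :> R)%R.
  rewrite (exprM _ 8 4); apply: (@le_trans _ _ ((4 / 5) ^+ 4)%R).
    by rewrite lerXn2r // ?nnegrE ?exprn_ge0 //; lra.
  by rewrite !exprS expr0; lra.
have pT : ((31 / 32) ^+ T <= (1 / 2) ^+ (20 * n * k) :> R)%R.
  apply: (@le_trans _ _ ((31 / 32) ^+ (32 * (20 * n * k)))%R).
    by apply: ler_wiXn2l; [lra | lra | lia].
  by rewrite exprM lerXn2r // ?nnegrE ?exprn_ge0 //; lra.
have h0 : (0 < 1 / 2 :> R)%R by lra.
apply: (@le_lt_trans _ _ (2 ^+ (18 * n * k) * (1 / 2) ^+ (20 * n * k))%R).
  apply: ler_pM => //; first by apply: exprn_ge0; lra.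
  by rewrite -natrX ler_nat.
have -> : 20 * n * k = 18 * n * k + 2 * n * k by lia.
rewrite exprD mulrA -exprMn (_ : 2 * (1 / 2) = 1 :> R)%R; last by field.
have h1 : (1 / 2 < 1 :> R)%R by lra.
by rewrite expr1n [ltLHS]mul1r ltr_iXn2l //; nia.
Qed.

Theorem theorem1p1 (R : realType) :
  exists (c C : R) (k0 N0 : nat),
    (0 < c)%R /\ (0 < C)%R /\
    forall N k : nat, N0 <= N -> k0 <= k -> k <= N ->
    exists S : schedule N (last_phase R k) (phase_length c k N),
    forall (A : {set 'I_N}) (wake : 'I_N -> nat), #|A| <= k ->
    forall v : 'I_N, v \in A ->
    succeeds_within (slofi S) A wake v
      (C * k%:R * log2 (k%:R : R) * log2 (N%:R : R))%R.
Proof.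
(* $2564 = 4 \cdot 641$: $k \ge 2$ gives $\log k \ge 1$, so $L + 1 \le 4 \log k$ and $T \le 641\, k
   \log N$. The threshold 1000 yields $640 N^2 + 1 < N^3$. *)
exists 640%:R%R, 2564%:R%R, 2, 1000; split; [by rewrite ltr0n | split; first by rewrite ltr0n].
move=> N k N0 k2 kN.
set L := last_phase R k; set T := phase_length _ k N.
set lk : R := log2 k%:R%R; set lN : R := log2 N%:R%R.
have k0 : 0 < k by lia.
have N1 : 0 < N by lia.
have N3 : 640 * N * N + 1 < N ^ 3.
  have : 1000 * (N * N) <= N * (N * N) by rewrite leq_mul2r N0 orbT.
  have : 0 < N * N by rewrite muln_gt0 N1.
  by rewrite !expnS expn0 muln1 -mulnA; lia.
have kR : (2 <= k%:R :> R)%R by rewrite ler_nat.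
have NR : (2 <= N%:R :> R)%R by rewrite ler_nat (leq_trans k2).
have kNR : (k%:R <= N%:R :> R)%R by rewrite ler_nat.
have lk1 : (1 <= lk)%R.
  by rewrite -[leLHS](log2_2X R 1) expr1 ler_log2 //; lra.
have lkN : (lk <= lN)%R by rewrite ler_log2 //; lra.
have lNN : (lN <= N%:R)%R by apply: log2_nat_le; lia.
have /andP[L1 L2] : (2 * lk <= L%:R < 2 * lk + 1)%R by apply: absz_ceil_itv; lra.
have /andP[T1 T2] : (640%:R * k%:R * lN <= T%:R < 640%:R * k%:R * lN + 1)%R.
  by apply: absz_ceil_itv; apply: mulr_ge0; [apply: mulr_ge0|]; rewrite ?ler0n //; lra.
have kL : k ^ 2 <= 2 ^ L.
  rewrite -(ler_nat R) !natrX -ler_log2 ?exprn_gt0 //; last by lra.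
  by rewrite log2X ?log2_2X //; lra.
have klN : (1 <= k%:R * lN)%R by nra.
have T0 : 0 < T by rewrite -(ltr_nat R); lra.
have nT : 640 * k * trunc_log 2 N <= T.
  rewrite -(ler_nat R) !natrM; apply: le_trans T1; apply: ler_wpM2l.
    by apply: mulr_ge0; rewrite ler0n.
  rewrite -log2_2X ler_log2 ?exprn_gt0 //; last by lra.
  by rewrite -natrX ler_nat trunc_logP.
have LN : L <= N.*2.+1.
  by rewrite -(ler_nat R) -addn1 -muln2 natrD natrM; lra.
have TN : T.+1 <= N ^ 3.
  apply: leq_ltn_trans N3.
  rewrite -(ler_nat R) natrD !natrM; apply: le_trans (ltW T2) _.
  by rewrite lerD2r -!mulrA ler_pM2l ?ltr0n //; apply: ler_pM => //; lra.
have [b good_b] := good_exists k0 T0 kL (failure_prob_lt R N0 k0 LN TN nT).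
exists (schedule_of b) => A wake Ak v vA.
have [r /andP[r1 rLT] succ] := success_by_last_phase k0 T0 kL good_b wake Ak vA.
exists r; split=> //; apply: (@le_trans _ _ (L.+1 * T)%:R%R); first by rewrite ler_nat.
rewrite natrM -natr1 -/lk -/lN.
apply: (@le_trans _ _ ((4 * lk) * (641%:R * (k%:R * lN)))%R).
  by apply: ler_pM; rewrite ?ler0n //; lra.
by rewrite le_eqVlt; apply/orP; left; apply/eqP; ring.
Qed.
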